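(* Fix an integer $n\geq 1$. For $1\le k\le n$ let $W_{n,k}(x)=\sum_{m=0}^{k}w_{n,k,m}x^m$, where $w_{n,k,m}$ is the number of Dyck paths of semilength $n$ with exactly $k$ occurrences of the factor $UD$ and exactly $m$ occurrences of the factor $UUD$. Then the sequence $\{W_{n,k}(x)\}_{1\leq k\leq n}$ is Sturm-unimodal, i.e. there exists $1\le j\le n$ such that $W_{n,1}(x)\preccurlyeq\cdots\preccurlyeq W_{n,j-1}(x)\preccurlyeq W_{n,j}(x)\succcurlyeq W_{n,j+1}(x)\succcurlyeq\cdots\succcurlyeq W_{n,n}(x)$.
   Context: A Dyck path of semilength $n$ is a lattice path from $(0,0)$ to $(2n,0)$ with steps $U=(1,1)$ and $D=(1,-1)$ never going below the $x$-axis; it is identified with its word in $\{U,D\}$, and a $UD$-factor (resp. $UUD$-factor) is an occurrence of the consecutive subword $UD$ (resp. $UUD$). Explicitly, $w_{n,k,m}=\frac{1}{k}\binom{n}{k-1}\binom{n-k-1}{m-1}\binom{k}{m}$ if $0<m\le k$ and $k+m\le n$; $w_{n,k,m}=1$ if $m=0$ and $n=k$; and $w_{n,k,m}=0$ otherwise. Each $W_{n,k}(x)$ is real-rooted with nonnegative coefficients. Interlacing: for real-rooted polynomials $F,G$ with nonnegative coefficients, with zeros $\alpha_1\ge\alpha_2\ge\cdots$ of $F$ and $\beta_1\ge\beta_2\ge\cdots$ of $G$, one writes $G\preccurlyeq F$ (equivalently $F\succcurlyeq G$) if either $\deg F=\deg G=n$ and $\beta_n\le\alpha_n\le\beta_{n-1}\le\alpha_{n-1}\le\cdots\le\beta_1\le\alpha_1$,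 or $\deg F=\deg G+1=n$ and $\alpha_n\le\beta_{n-1}\le\alpha_{n-1}\le\cdots\le\beta_1\le\alpha_1$. By convention $a\preccurlyeq bx+c$ for all real $a,b,c$, and $F\preccurlyeq 0$, $0\preccurlyeq F$ for every real-rooted $F$. *)

(* Defs.v *)
From mathcomp Require Import all_boot all_order all_algebra.
From mathcomp Require Import reals.

Set Implicit Arguments.
Unset Strict Implicit.
Unset Printing Implicit Defensive.

Import Order.TTheory GRing.Theory Num.Theory.
Local Open Scope ring_scope.

(* Lattice paths are words over {U, D}, encoded as booleans so that words of a
   fixed length form a finType. *)
Definition U : bool := true.
Definition D : bool := false.

(* The height after i steps is (#U - #D) in the prefix of length i; it must
   stay nonnegative and end at 0. *)
Definition is_dyck (s : seq bool) : bool :=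
  [forall i : 'I_(size s).+1,
     count_mem D (take i s) <= count_mem U (take i s)]%N
  && (count_mem U s == count_mem D s).

Definition factor_count (u s : seq bool) : nat :=
  count (fun i => prefix u (drop i s)) (iota 0 (size s)).

Definition dyck_count (n k m : nat) : nat :=
  #|[set p : (2 * n).-tuple bool
      | [&& is_dyck p,
            factor_count [:: U; D] p == k
          & factor_count [:: U; U; D] p == m]]|.

Definition W (R : realType) (n k : nat) : {poly R} :=
  \sum_(m < k.+1) (dyck_count n k m)%:R *: 'X^m.

(* s lists the zeros of the nonzero polynomial p with multiplicity, in
   nonincreasing order; such an s exists iff p is nonzero and real-rooted. *)
Definition zeros_of (R : realType) (p : {poly R}) (s : seq R) : Prop :=
  [/\ p != 0, sorted >=%R s
    & p = lead_coef p *: \prod_(a <- s) ('X - a%:P)].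

Definition real_rooted (R : realType) (p : {poly R}) : Prop :=
  p = 0 \/ exists s : seq R, zeros_of p s.

Definition nonneg_coefs (R : realType) (p : {poly R}) : Prop :=
  forall i : nat, 0 <= p`_i.

(* alpha and beta are the zeros of F and G; indices are shifted down by one
   with respect to alpha_1 >= alpha_2 >= ... and beta_1 >= beta_2 >= ... .
   Both clauses ask for
     ... <= alpha_2 <= beta_1 <= alpha_1,
   the chain ending in beta_n <= alpha_n when the degrees agree and in
   alpha_n <= beta_(n-1) when deg F = deg G + 1. *)
Definition zeros_interlace (R : realType) (beta alpha : seq R) : Prop :=
  (size alpha = size beta /\
   (forall i, (i < size alpha)%N -> beta`_i <= alpha`_i) /\
   (forall i, (i.+1 < size alpha)%N -> alpha`_i.+1 <= beta`_i))
  \/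
  (size alpha = (size beta).+1 /\
   (forall i, (i < size beta)%N -> alpha`_i.+1 <= beta`_i <= alpha`_i)).

(* interlaces G F is G ≼ F. The last three disjuncts are the conventions
   a ≼ b x + c, 0 ≼ F and F ≼ 0. *)
Definition interlaces (R : realType) (G F : {poly R}) : Prop :=
  (nonneg_coefs G /\ nonneg_coefs F /\
   exists beta alpha : seq R,
     [/\ zeros_of G beta, zeros_of F alpha & zeros_interlace beta alpha])
  \/ (exists a b c : R, G = a%:P /\ F = b *: 'X + c%:P)
  \/ (G = 0 /\ real_rooted F)
  \/ (F = 0 /\ real_rooted G).

(* P is indexed from 1 to n; values outside this range are ignored. *)
Definition sturm_unimodal (R : realType) (n : nat) (P : nat -> {poly R}) : Prop :=
  exists j : nat,
    [/\ (1 <= j <= n)%N,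
        forall k, (1 <= k < j)%N -> interlaces (P k) (P k.+1)
      & forall k, (j <= k < n)%N -> interlaces (P k.+1) (P k)].

(* Main.v *)
Require Import Defs.
From mathcomp Require Import all_boot all_order all_algebra.
From mathcomp Require Import reals ring lra zify.
From mathcomp Require polyrcf.

(* Appending a D to a Dyck path of semilength n and cutting after each D turns
   it into a sequence of n + 1 (possibly empty) U-runs;
   a UD-factor is a nonempty run and a UUD-factor a run of length at least 2.
   By the cycle lemma, (n + 1) W_{n,k}(x) is the generating function of all
   sequences of n + 1 runs of total length n with k nonempty ones, so that for
   k < n it is a positive multiple of x Q_{k-1,n-k-1}(x), where
   Q_{p,q}(x) = sum_j C(p,j) C(q,j) x^j / (j+1) = 2F1(-p,-q;2;x) is symmetric
   in p and q.  For d = q - p > 0, the contiguous relation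
     (q+1)(p+2) Q_{p+1,q}
       = (q+1) (p+2 + d x) Q_{p,q+1} + d (1-x) x Q_{p,q+1}'
   shows that Q_{p+1,q} and the derivative of Q_{p,q+1} have opposite signs at
   the negative zeros of Q_{p,q+1}; hence the zeros interlace, and the sequence
   W_{n,k} rises up to k = n/2 and falls afterwards. *)

Set Implicit Arguments.
Unset Strict Implicit.
Unset Printing Implicit Defensive.

Import Order.TTheory GRing.Theory Num.Theory.
Local Open Scope ring_scope.

(** * Dyck words and their U-runs *)

(** An arbitrary starting height makes the Dyck condition recursive in the word. *)
Fixpoint dyck_from (h : nat) (s : seq bool) : bool :=
  match s with
  | [::] => h == 0%N
  | b :: s' => if b then dyck_from h.+1 s' else (0 < h)%N && dyck_from h.-1 s'
  end.

Lemma dyck_fromP h s :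
  reflect ((forall i, (i <= size s)%N ->
              (count_mem D (take i s) <= h + count_mem U (take i s))%N)
           /\ (h + count_mem U s = count_mem D s)%N)
          (dyck_from h s).
Proof.
have ctrue b (t : seq bool) :
    count_mem b (true :: t) = ((b : nat) + count_mem b t)%N by case: b.
have cfalse b (t : seq bool) :
    count_mem b (false :: t) = ((~~ b : nat) + count_mem b t)%N by case: b.
rewrite /U /D; apply: (iffP idP); elim: s h => [|[] s IH] h.
- by move/eqP->; split => // -[].
- move=> /IH [H1 H2]; split=> [[|i]|];
    last by rewrite !(ctrue, cfalse); move: H2 => /=; lia.
    by rewrite take0.
  by move/H1; rewrite take_cons !(ctrue, cfalse) /=; lia.
- case: h => // h H; have [H1 H2] := IH h H; split=> [[|i]|];
    last by rewrite !(ctrue, cfalse); move: H2 => /=; lia.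
    by rewrite take0.
  by move/H1; rewrite take_cons !(ctrue, cfalse) /=; lia.
- by case=> _ /=; lia.
- case=> H1 H2; apply: IH; split;
    last by move: H2; rewrite !(ctrue, cfalse) /=; lia.
  by move=> i Hi; have := H1 i.+1 Hi; rewrite take_cons !(ctrue, cfalse) /=; lia.
- case=> H1 H2; have h0 : (0 < h)%N.
    by have := H1 1%N isT; rewrite take_cons take0 !(ctrue, cfalse) /=; lia.
  rewrite /= h0 /=; apply: IH; split;
    last by move: H2; rewrite !(ctrue, cfalse) /=; lia.
  by move=> i Hi; have := H1 i.+1 Hi; rewrite take_cons !(ctrue, cfalse) /=; lia.
Qed.

Lemma is_dyckE s : is_dyck s = dyck_from 0 s.
Proof.
apply/idP/dyck_fromP => [/andP[/forallP H /eqP ->]|[H1 H2]].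
  by split=> // i Hi; rewrite add0n; have := H (Ordinal (Hi : (i < (size s).+1)%N)).
rewrite /is_dyck -H2 eqxx andbT; apply/forallP => i.
by apply: H1; rewrite -ltnS.
Qed.

Lemma dyck_from_size h s : dyck_from h s -> (h <= size s)%N.
Proof.
elim: s h => [|[] s IH] h /=; first by move/eqP->.
  by move/IH; lia.
by case/andP=> h0 /IH; lia.
Qed.

Lemma factor_count_cons u b s :
  factor_count u (b :: s) = (prefix u (b :: s) + factor_count u s)%N.
Proof. by rewrite /factor_count /= -[1%N]addn0 iotaDl count_map. Qed.

Lemma factor_count_UD_run j s :
  factor_count [:: U; D] (nseq j U ++ D :: s)
  = ((0 < j) + factor_count [:: U; D] s)%N.
Proof.
elim: j => [|j IH]; first by rewrite factor_count_cons.
rewrite [nseq _ _ ++ _]/= factor_count_cons IH.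
by case: j {IH} => [|j] /=; rewrite ?prefix0s.
Qed.

Lemma factor_count_UUD_run j s :
  factor_count [:: U; U; D] (nseq j U ++ D :: s)
  = ((1 < j) + factor_count [:: U; U; D] s)%N.
Proof.
elim: j => [|j IH]; first by rewrite factor_count_cons.
rewrite [nseq _ _ ++ _]/= factor_count_cons IH.
by case: j {IH} => [|[|j]] /=; rewrite ?prefix0s.
Qed.

Lemma factor_count_UUD_le s :
  (factor_count [:: U; U; D] s <= factor_count [:: U; D] s)%N.
Proof.
(* Each UUD-factor is charged to the UD-factor one position later; a UD at the very start receives
   no charge, and this slack carries the induction. *)
suff : (factor_count [:: U; U; D] s + prefix [:: U; D] s
        <= factor_count [:: U; D] s)%N by lia.
elim: s => [//|b s IH]; rewrite !factor_count_cons.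
have -> : prefix [:: U; U; D] (b :: s) = b && prefix [:: U; D] s by case: b.
by move: IH; case: b => /=; lia.
Qed.

(** * Path generating functions and the cycle lemma *)

Lemma big_tuple_cons (V : nmodType) (T : finType) n (F : n.+1.-tuple T -> V) :
  \sum_(s : n.+1.-tuple T) F s
  = \sum_(b : T) \sum_(s : n.-tuple T) F (cons_tuple b s).
Proof.
rewrite pair_bigA (reindex (fun p : T * n.-tuple T => cons_tuple p.1 p.2)) //=.
exists (fun s => (thead s, behead_tuple s)) => [[b s]|s] _ /=.
  by congr pair; apply: val_inj.
by rewrite [s in RHS]tuple_eta; apply: val_inj.
Qed.

Lemma coef_mulX_deriv (A : nzRingType) (p : {poly A}) i :
  ('X * p^`())`_i = p`_i *+ i.
Proof. by rewrite coefXM; case: i => [|i] /=; rewrite ?mulr0n ?coef_deriv. Qed.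

Lemma mulX_deriv_exp (A : comNzRingType) (p : {poly A}) N :
  'X * (p ^+ N.+1)^`() = ('X * p^`()) * p ^+ N *+ N.+1.
Proof. by rewrite deriv_exp /= mulrnAr mulrA. Qed.

Lemma poly2_mulrnI (R : numDomainType) N :
  injective (fun x : {poly {poly R}} => x *+ N.+1).
Proof.
move=> x y /= E; apply/polyP => i; apply/polyP => j.
have := congr1 (fun p : {poly {poly R}} => p`_i`_j) E.
by rewrite !coefMn => /eqP; rewrite eqrMn2r => /eqP.
Qed.

Section PathWeights.
Variable R : numDomainType.
Local Notation K := {poly {poly R}}.

(* The outer variable marks UD-factors, the inner one UUD-factors. *)
Definition path_weight (s : seq bool) : K :=
  ('X^(factor_count [:: U; U; D] s))%:P * 'X^(factor_count [:: U; D] s).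

Definition run_weight (u : nat) : K :=
  ('X^(1 < u)%N)%:P * 'X^(0 < u)%N.

(** The [j] prepended U's stand for the part of the current run already read; they count for the
    weight only, and [h] is the height after them. *)
Definition paths_gf (j L h : nat) : K :=
  \sum_(s : L.-tuple bool | dyck_from h s) path_weight (nseq j U ++ s).

Lemma path_weight_run j s :
  path_weight (nseq j U ++ D :: s) = run_weight j * path_weight s.
Proof.
rewrite /path_weight factor_count_UD_run factor_count_UUD_run /run_weight.
by rewrite !exprD polyCM mulrACA.
Qed.

Lemma paths_gf_small j L h : (L < h)%N -> paths_gf j L h = 0.
Proof.
move=> Lh; rewrite /paths_gf big1 // => s /dyck_from_size.
by rewrite size_tuple leqNgt Lh.
Qed.

(** A first letter D closes the open run, which contributes [run_weight j]; a first letter U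
    lengthens it. *)
Lemma paths_gfS j L h :
  paths_gf j L.+1 h = (if h is h'.+1 then run_weight j * paths_gf 0 L h' else 0)
                      + paths_gf j.+1 L h.+1.
Proof.
rewrite /paths_gf big_mkcond big_tuple_cons big_bool [RHS]addrC /=.
congr (_ + _); last first.
  case: h => [|h]; first by rewrite big1.
  rewrite mulr_sumr [RHS]big_mkcond; apply: eq_bigr => s _ /=.
  by case: ifP => // _; rewrite path_weight_run.
rewrite [RHS]big_mkcond; apply: eq_bigr => s _ /=; case: ifP => // _.
by congr path_weight; elim: j => //= j ->.
Qed.

Variable M : nat.
(** The outermost variable marks run length; truncation keeps this a polynomial and does not affect
    coefficients of its powers below [M]. *)
Definition runs_gf : {poly K} := \poly_(u < M) run_weight u.

Lemma coef_runs_gfM p r : (r < M)%N ->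
  (runs_gf * p)`_r = \sum_(u < r.+1) run_weight u * p`_(r - u).
Proof.
move=> rM; rewrite coefM; apply: eq_bigr => u _; rewrite coef_poly.
by rewrite (leq_ltn_trans _ rM) // -ltnS.
Qed.

(* The runs are exchangeable, so the first of N.+1 runs of total length r has
   average length r / N.+1; this replaces the rotations of the cycle lemma. *)
Lemma first_run_average N r : (r < M)%N ->
  (runs_gf ^+ N.+1)`_r *+ r
  = (\sum_(u < r.+1) run_weight u * (runs_gf ^+ N)`_(r - u) *+ u) *+ N.+1.
Proof.
move=> rM; rewrite -coef_mulX_deriv mulX_deriv_exp coefMn; congr (_ *+ _).
rewrite coefM; apply: eq_bigr => u _; rewrite coef_mulX_deriv coef_poly.
by rewrite (leq_ltn_trans _ rM) ?mulrnAl // -ltnS.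
Qed.

Lemma paths_gf_total r h : (r < M)%N ->
  (0 < h + r)%N ->
  paths_gf 0 (h + r.*2) h *+ (h + r) =
    \sum_(u < r.+1) run_weight u * (runs_gf ^+ (h + r))`_(r - u) *+ (h + u) ->
  paths_gf 0 (h + r.*2) h *+ (h + r).+1
  = (runs_gf ^+ (h + r).+1)`_r *+ h.+1.
Proof.
move=> rM N0 E; case HN: (h + r)%N N0 E => [//|N] _ E.
apply: (@poly2_mulrnI _ N); rewrite /= mulrnAC E.
have -> : \sum_(u < r.+1) run_weight u * (runs_gf ^+ N.+1)`_(r - u) *+ (h + u)
   = (runs_gf ^+ N.+2)`_r *+ h
     + \sum_(u < r.+1) run_weight u * (runs_gf ^+ N.+1)`_(r - u) *+ u.
  rewrite [in RHS]exprS coef_runs_gfM // -sumrMnl -big_split /=.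
  by apply: eq_bigr => u _; rewrite mulrnDr.
(* With [N.+1 = h + r], the multiplicities agree because h (h+r+1) + r = (h+1) (h+r). *)
rewrite mulrnDl -first_run_average // -!mulrnA -mulrnDr; congr (_ *+ _).
by move: HN; nia.
Qed.

(* On a path from height h with r steps U, the first part splits off the run
   that extends the j steps U already read; the second is the ballot form of
   the cycle lemma. *)
Lemma paths_gf_closed L j r h : (L = h + r.*2)%N -> (r < M)%N ->
  ((0 < L)%N -> paths_gf j L h *+ (h + r) =
    \sum_(u < r.+1) run_weight (j + u) * (runs_gf ^+ (h + r))`_(r - u) *+ (h + u))
  /\ paths_gf 0 L h *+ (h + r).+1 = (runs_gf ^+ (h + r).+1)`_r *+ h.+1.
Proof.
elim: L j r h => [|L IH] j r h EL rM.
  have [h0 r0] : (h = 0 /\ r = 0)%N by lia.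
  subst h r; split=> //; rewrite expr1 coef_poly rM.
  rewrite /paths_gf (big_pred1 [tuple]) /=.
    by rewrite /path_weight /run_weight /= !expr0.
  by move=> s; rewrite [s]tuple0; symmetry; apply/eqP.
(* Here [u] counts the further U's of the open run: [u = 0] means that D comes next, which is the
   second part at height [h - 1]; the other terms are the first part with [j] increased. *)
have claim j' : paths_gf j' L.+1 h *+ (h + r) =
    \sum_(u < r.+1) run_weight (j' + u) * (runs_gf ^+ (h + r))`_(r - u) *+ (h + u).
  rewrite paths_gfS mulrnDl big_ord_recl addn0 subn0 addn0; congr (_ + _).
    case: h EL => [|h] EL; first by rewrite mul0rn mulr0n.
    have [_] := IH 0%N r h ltac:(lia) rM.
    by rewrite -addSn -!mulrnAr => ->.
  case: r EL rM => [|r] EL rM.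
    by rewrite big_ord0 paths_gf_small ?mul0rn //; lia.
  have [] := IH j'.+1 r h.+1 ltac:(lia) ltac:(lia).
  move=> /(_ ltac:(lia)) H _; rewrite -addSnnS H.
  by apply: eq_bigr => u _; rewrite lift0 subSS !addSnnS.
split=> [_|]; first exact: claim.
by have := claim 0%N; rewrite EL; apply: paths_gf_total => //; lia.
Qed.

End PathWeights.

Lemma W_coef_paths_gf (R : realType) n k : W R n k = (paths_gf R 0 (2 * n) 0)`_k.
Proof.
rewrite /paths_gf coef_sum /=.
rewrite (eq_bigr (fun s : (2 * n).-tuple bool =>
   if factor_count [:: U; D] s == k then 'X^(factor_count [:: U; U; D] s) else 0));
  last first.
  move=> s _; rewrite /path_weight coefCM coefXn eq_sym.
  by case: eqP => _; rewrite ?mulr1 ?mulr0.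
rewrite -big_mkcondr /=.
(* On contributing words the UUD-count is at most [k], so [inord] loses nothing. *)
rewrite (partition_big (fun s : (2 * n).-tuple bool =>
    inord (factor_count [:: U; U; D] s) : 'I_k.+1) predT) //=.
apply: eq_bigr => m _; rewrite scaler_nat.
have inordE (s : (2 * n).-tuple bool) : factor_count [:: U; D] s = k ->
   (inord (factor_count [:: U; U; D] s) == m) = (factor_count [:: U; U; D] s == m).
  by move=> Ek; rewrite -val_eqE /= inordK // ltnS -Ek factor_count_UUD_le.
rewrite (eq_bigr (fun=> 'X^m)); last first.
  by move=> s /andP[/andP[_ /eqP Es]]; rewrite inordE // => /eqP ->.
rewrite sumr_const /dyck_count cardsE; congr (_ *+ _); apply: eq_card => s.
rewrite !unfold_in /= is_dyckE; case: dyck_from => //=.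
by case: eqP => //= Es; rewrite inordE.
Qed.

(** * Extraction of binomial coefficients *)

Lemma sum_bin_diag m j : (\sum_(i < j.+1) 'C(m + i, m) = 'C((m + j).+1, m.+1))%N.
Proof.
elim: j => [|j IH]; first by rewrite big_ord_recl big_ord0 !addn0 !binn.
by rewrite big_ord_recr /= IH addnS [RHS]binS.
Qed.

(** Below [M] the truncation is not felt, so these are the coefficients of (1-z)^-(m+1). *)
Lemma coef_geometric_exp (A : comNzRingType) M m j : (j < M)%N ->
  ((\poly_(i < M) 1 : {poly A}) ^+ m.+1)`_j = 'C(m + j, m)%:R.
Proof.
elim: m j => [|m IH] j jM; first by rewrite expr1 coef_poly jM bin0.
rewrite exprSr coefM addSn -sum_bin_diag natr_sum; apply: eq_bigr => i _.
have iM : (i < M)%N by apply: leq_ltn_trans jM; rewrite -ltnS.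
by rewrite IH // coef_poly (leq_ltn_trans (leq_subr _ _) jM) mulr1.
Qed.

Section RunCoefficients.
Variable R : numDomainType.
Variable M : nat.
Local Notation geom := (\poly_(i < M) 1 : {poly {poly R}}).
Local Notation nonempty_runs := ('X * (1 + 'X *: ('X * geom)) : {poly {poly R}}).

(** With z for length, y for nonempty runs and x for runs of length at least 2, this is 1 + y z (1 +
    x z/(1-z)), truncated; the [M] terms of [geom] are shifted by two. *)
Lemma runs_gf_split :
  runs_gf R M.+2 = 1 + 'X *: map_poly (@polyC {poly R}) nonempty_runs.
Proof.
apply/polyP => u; rewrite coef_poly coefD coefZ coef1 coef_map /=.
case: u => [|[|u]]; rewrite !(coefD, coefZ, coef1, coefXM, coef_poly) /=.
- by rewrite /run_weight /= !expr0 mulr1 polyC0 mulr0 addr0.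
- by rewrite /run_weight /= expr0 expr1 mul1r mulr0 addr0 mulr1 add0r.
- rewrite /run_weight /= !expr1 !add0r !ltnS mulrC.
  by case: ifP => _; rewrite ?mulr1 // mulr0 polyC0 mulr0.
Qed.

(** The factor ['C(N, k)] chooses the nonempty runs. *)
Lemma coef_runs_gf_exp N r k : (k <= N)%N ->
  (runs_gf R M.+2 ^+ N)`_r`_k = (nonempty_runs ^+ k)`_r *+ 'C(N, k).
Proof.
move=> kN; rewrite runs_gf_split addrC exprD1n coef_sum coef_sum.
rewrite (bigD1 (inord k : 'I_N.+1)) //= big1 ?addr0 => [|i ik].
  rewrite inordK // !coefMn exprZn coefZ -rmorphXn /= coef_map /= mulrC.
  by rewrite coefCM coefXn eqxx mulr1.
rewrite !coefMn exprZn coefZ -rmorphXn /= coef_map /= mulrC coefCM coefXn.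
rewrite (_ : (k == i) = false) ?mulr0 ?mul0rn //.
by apply/negbTE; apply: contraNN ik => /eqP ->; rewrite inord_val.
Qed.

(** The factor ['C(k, m)] chooses the runs of length at least 2. Every run takes one U, each chosen
    run a second one, and the other [r - m] are spread over the chosen runs. *)
Lemma coef_nonempty_runs_exp k r m : (r < M)%N -> (m <= k)%N ->
  (nonempty_runs ^+ k)`_(k + r)`_m
  = (if (m <= r)%N then (geom ^+ m)`_(r - m)`_0 else 0) *+ 'C(k, m).
Proof.
move=> rM mk; rewrite exprMn coefXnM ltnNge leq_addr /= addKn.
rewrite addrC exprD1n coef_sum coef_sum.
have E (i : nat) : ('X *: ('X * geom)) ^+ i = 'X^i *: ('X^i * geom ^+ i).
  by rewrite exprZn exprMn.
have G (i j : nat) : (geom ^+ i)`_j = ((geom ^+ i)`_j`_0)%:P.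
  have -> : geom = map_poly (@polyC R) (\poly_(i < M) 1).
    by apply/polyP => l; rewrite coef_map !coef_poly; case: ifP.
  by rewrite -rmorphXn /= coef_map /= coefC.
rewrite (bigD1 (inord m : 'I_k.+1)) //= big1 ?addr0 => [|i im].
  rewrite inordK // E !coefMn coefZ (coefXnM _ (_ : {poly {poly R}})) ltnNge.
  case: leqP => /= _.
    by rewrite G coefMC coefXn eqxx mul1r coefC.
  by rewrite mulr0 coef0.
rewrite E !coefMn coefZ (coefXnM _ (_ : {poly {poly R}})).
case: ifP => _; first by rewrite mulr0 coef0 mul0rn.
rewrite G coefMC coefXn (_ : (m == i) = false) ?mul0r ?mul0rn //.
by apply/negbTE; apply: contraNN im => /eqP ->; rewrite inord_val.
Qed.

End RunCoefficients.

Lemma W_coef_nonempty_runs (R : realType) n k m : (0 < k <= n)%N -> (m <= k)%N ->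
  (W R n k)`_m *+ n.+1
  = (if (m <= n - k)%N
     then ((\poly_(i < n) 1 : {poly {poly R}}) ^+ m)`_(n - k - m)`_0
     else 0) *+ 'C(k, m) *+ 'C(n.+1, k).
Proof.
move=> /andP[k0 kn] mk.
have [|_] := @paths_gf_closed R n.+2 (2 * n)%N 0 n 0 _ (leqnSn _).
  by rewrite mul2n.
rewrite add0n => /(congr1 (fun p : {poly {poly R}} => p`_k`_m)).
rewrite !coefMn -W_coef_paths_gf => ->; rewrite mulr1n.
rewrite coef_runs_gf_exp ?(leq_trans kn) // coefMn; congr (_ *+ _).
by have := @coef_nonempty_runs_exp R n k (n - k) m; rewrite subnKC // => -> //; lia.
Qed.

(** * Hypergeometric form and contiguous relation *)

Lemma coef_W_gt (R : realType) n k m : (k < m)%N -> (W R n k)`_m = 0.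
Proof.
move=> km; rewrite /W coef_sum big1 // => i _; rewrite coefZ coefXn.
by rewrite gtn_eqF ?mulr0 // (leq_ltn_trans _ km) // -ltnS.
Qed.

Definition hypgeo (R : realType) p q : {poly R} :=
  \poly_(j < p.+1) (('C(p, j) * 'C(q, j))%:R / j.+1%:R).

Lemma coef_hypgeo (R : realType) p q j :
  (hypgeo R p q)`_j = ('C(p, j) * 'C(q, j))%:R / j.+1%:R.
Proof.
by rewrite coef_poly; case: ltnP => // pj; rewrite bin_small // mul0n mul0r.
Qed.

Lemma hypgeoC (R : realType) p q : hypgeo R p q = hypgeo R q p.
Proof. by apply/polyP => j; rewrite !coef_hypgeo mulnC. Qed.

(** Here all nonempty runs have length 1, so no UUD occurs; this end of the sequence is not a
    multiple of x. *)
Lemma W_diag (R : realType) n : (0 < n)%N -> W R n n = 1.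
Proof.
move=> n0; apply/polyP => m; rewrite coef1; apply/eqP.
case: (leqP m n) => mn; last by rewrite coef_W_gt // gtn_eqF // (leq_ltn_trans _ mn).
have := @W_coef_nonempty_runs R n n m; rewrite n0 leqnn => /(_ isT mn) /eqP.
rewrite subnn leqn0; case: (posnP m) => [-> | m0] /=.
  by rewrite expr0 !coef1 bin0 binSn mulr1n eqrMn2r.
by rewrite !mul0rn mulrn_eq0.
Qed.

Lemma W_hypgeo (R : realType) n k : (0 < k < n)%N ->
  W R n k = ('C(n.+1, k)%:R * k%:R / n.+1%:R) *: ('X * hypgeo R k.-1 (n - k).-1).
Proof.
move=> /andP[k0 kn]; apply/polyP => m; rewrite coefZ coefXM.
have nz (i : nat) : i.+1%:R != 0 :> R by rewrite pnatr_eq0.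
case: (leqP m k) => mk; last first.
  rewrite coef_W_gt //; case: m mk => // m mk.
  by rewrite coef_hypgeo (@bin_small k.-1) ?mul0n ?mul0r ?mulr0 //=; lia.
have := @W_coef_nonempty_runs R n k m; rewrite k0 ltnW // => /(_ isT mk) E.
apply: (mulIf (nz n)); rewrite [LHS]mulr_natr E.
case: m mk {E} => [|m] mk /=.
  rewrite expr0 coef1 subn0 mulr0 mul0r.
  by rewrite subn_eq0 leqNgt kn coef0 !mul0rn.
rewrite coef_hypgeo; case: (leqP m.+1 (n - k)) => mnk; last first.
  have mnk' : ((n - k).-1 < m)%N by lia.
  by rewrite (@bin_small _ m mnk') ?muln0 ?mul0r ?mulr0 ?mul0rn ?mul0r.
rewrite coef_geometric_exp; last by lia.
have -> : (m + (n - k - m.+1))%N = (n - k).-1 by lia.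
(* Absorption trades ['C(k, m.+1)] for ['C(k.-1, m)] over [m.+1], as in [hypgeo]. *)
have H : k%:R * 'C(k.-1, m)%:R = m.+1%:R * 'C(k, m.+1)%:R :> R.
  by rewrite -!natrM mul_bin_diag.
rewrite -polyC_natr coefC /= natrM -[LHS]mulr_natr -[X in X * _ = _]mulr_natr.
have alg (a k' c d M N e : R) : M != 0 -> N != 0 -> k' * c = M * e ->
    d * e * a = a * k' / N * (c * d / M) * N.
  move=> M0 N0 E; transitivity (a * (k' * c) * d / M); first by rewrite E; field.
  by field; apply/andP.
by apply: alg H; apply: nz.
Qed.

Lemma hypgeo_contiguous (R : realType) p q : (p <= q)%N ->
  (q.+1%:R * p.+2%:R) *: hypgeo R p.+1 q
  = q.+1%:R *: (hypgeo R p q.+1 * (p.+2%:R%:P + (q - p)%:R *: 'X))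
    + (q - p)%:R *: ((1 - 'X) * ('X * (hypgeo R p q.+1)^`())).
Proof.
move=> pq; apply/polyP => i.
set G := hypgeo R p q.+1.
have -> : G * (p.+2%:R%:P + (q - p)%:R *: 'X)
       = p.+2%:R *: G + (q - p)%:R *: (G * 'X).
  by rewrite [LHS]mulrDr -scalerAr mulrC mul_polyC.
have -> : (1 - 'X) * ('X * G^`()) = 'X * G^`() - ('X * G^`()) * 'X.
  by rewrite [LHS]mulrBl mul1r [X in _ - X]mulrC.
rewrite !(coefD, coefZ, coefMX, coefN, coef_mulX_deriv) {}/G.
case: i => [|i] /=.
  by rewrite !coef_hypgeo !bin0 mulr0 mulr0n; field.
rewrite !coef_hypgeo -[_ / _ *+ i]mulr_natr -[_ / _ *+ i.+1]mulr_natr.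
have nz (j : nat) : j.+1%:R != 0 :> R by rewrite pnatr_eq0.
(* For [p < i] the binomials on [p] and [p.+1] vanish; otherwise [i <= p <= q] keeps [q.+1 - i]
   nonzero. *)
case: (ltnP p i) => ip.
  rewrite (@bin_small p i) // (@bin_small p i.+1)
    ?(@bin_small p.+1 i.+1) ?mul0n ?mul0r; try lia.
  by rewrite !(mul0r, mulr0, subr0, addr0).
(* Expressing every binomial through ['C(p, i)] and ['C(q, i)] leaves a rational identity. *)
have a'E : 'C(p, i.+1)%:R = (p%:R - i%:R) * 'C(p, i)%:R / i.+1%:R :> R.
  apply: (mulIf (nz i)); rewrite divfK // -natrB // -[RHS]natrM -[LHS]natrM mulnC.
  by rewrite mul_bin_left.
have b'E : 'C(q, i.+1)%:R = (q%:R - i%:R) * 'C(q, i)%:R / i.+1%:R :> R.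
  apply: (mulIf (nz i)); rewrite divfK // -natrB ?(leq_trans ip) // -!natrM mulnC.
  by rewrite mul_bin_left.
have qi : q.+1%:R - i%:R != 0 :> R.
  by rewrite -natrB ?pnatr_eq0; lia.
have b''E : 'C(q.+1, i)%:R = q.+1%:R * 'C(q, i)%:R / (q.+1%:R - i%:R) :> R.
  apply: (mulIf qi); rewrite divfK // -natrB -?natrM; last by lia.
  by rewrite mulnC -(mul_bin_down q.+1).
have a1E : 'C(p.+1, i.+1)%:R = 'C(p, i.+1)%:R + 'C(p, i)%:R :> R
  by rewrite binS natrD.
have b1E : 'C(q.+1, i.+1)%:R = 'C(q, i.+1)%:R + 'C(q, i)%:R :> R
  by rewrite binS natrD.
rewrite !natrM a1E b1E a'E b'E b''E natrB //.
have nz1 := nz i; have nz2 := nz i.+1; move: qi nz1 nz2 {a'E b'E b''E a1E b1E}.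
rewrite -(natr1 i.+1) -!(natr1 i) -(natr1 p.+1) -(natr1 p) -(natr1 q).
move: ('C(p, i)%:R : R) ('C(q, i)%:R : R) (p%:R : R) (q%:R : R) (i%:R : R)
  => a b P Q I.
move=> h1 h2 h3; field.
by rewrite h1 h2 h3.
Qed.

(** * Sign changes, zeros and interlacing *)

Lemma prod_XsubC_gt0 (R : realType) (s : seq R) x :
  all (< x) s -> 0 < (\prod_(a <- s) ('X - a%:P)).[x].
Proof.
elim: s => [|b s IH] /=; first by rewrite big_nil hornerC ltr01.
by case/andP=> bx /IH H; rewrite big_cons hornerM hornerXsubC mulr_gt0 ?subr_gt0.
Qed.

(** At the zero of index [i], exactly [i] of the remaining factors are negative, those of the larger
    zeros. *)
Lemma deriv_prod_XsubC_sign (R : realType) (s : seq R) i :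
  sorted >%R s -> (i < size s)%N ->
  0 < (-1) ^+ i * (\prod_(a <- s) ('X - a%:P))^`().[s`_i].
Proof.
elim: s i => [//|b s IH] i /= bs.
have sb : all (< b) s.
  by apply: (order_path_min _ bs); move=> x y z xy yz; apply: lt_trans yz xy.
rewrite big_cons derivM derivXsubC mul1r hornerD hornerM hornerXsubC.
case: i => [_|i si] /=.
  by rewrite expr0 mul1r subrr mul0r addr0 prod_XsubC_gt0.
have -> : (\prod_(a <- s) ('X - a%:P)).[s`_i] = 0.
  by apply/rootP; rewrite root_prod_XsubC mem_nth.
have := IH i (path_sorted bs) si.
have : s`_i < b by have /allP := sb; apply; rewrite mem_nth.
rewrite exprS; set d := (\prod_(_ <- _) _)^`().[_]; set e := (-1) ^+ i.
by move=> *; nra.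
Qed.

(** The intermediate value theorem gives a zero in each gap, and these [d] distinct zeros exhaust
    the degree. *)
Lemma zeros_of_sign_alternation (R : realType) (F : {poly R}) (b : nat -> R) d :
  size F = d.+1 ->
  (forall i, (i < d)%N -> b i.+1 < b i) ->
  (forall i, (i <= d)%N -> 0 < (-1) ^+ i * F.[b i]) ->
  exists s : seq R,
    [/\ size s = d, sorted >%R s, F = lead_coef F *: \prod_(a <- s) ('X - a%:P)
      & forall i, (i < d)%N -> b i.+1 < s`_i < b i].
Proof.
move=> szF bdec sgn.
have ivt (i : 'I_d) : exists x, (b i.+1 < x < b i) && root F x.
  have s1 := sgn i (ltnW (ltn_ord i)); have s2 := sgn i.+1 (ltn_ord i).
  rewrite exprS mulN1r mulNr oppr_gt0 in s2.
  have [] := @poly_ivt R ((-1) ^+ i *: F) _ _ (ltW (bdec i (ltn_ord i))).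
    by rewrite !hornerZ (ltW s1) (ltW s2).
  move=> x /andP[x1 x2]; rewrite rootZ ?signr_eq0 // => Fx; exists x.
  rewrite Fx andbT !lt_neqAle x1 x2 !andbT.
  apply/andP; split; apply/eqP => E; move: Fx; rewrite rootE => /eqP F0.
    by move: s2; rewrite E F0 mulr0 ltxx.
  by move: s1; rewrite -E F0 mulr0 ltxx.
have [f fP] := fin_all_exists ivt.
have fP' i (id : (i < d)%N) := fP (Ordinal id).
pose s := mkseq (fun i => if insub i is Some j then f j else 0) d.
have sE i (id : (i < d)%N) : s`_i = f (Ordinal id) by rewrite nth_mkseq // insubT.
have sb i : (i < d)%N -> b i.+1 < s`_i < b i.
  by move=> id; rewrite sE; have /andP[] := fP' i id.
have szs : size s = d by rewrite size_mkseq.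
have srt : sorted >%R s.
  apply/(sortedP 0) => i; rewrite szs => id.
  have /andP[_ h1] := sb _ id; have /andP[h2 _] := sb _ (ltnW id).
  exact: lt_trans h1 h2.
exists s; split=> //; apply: all_roots_prod_XsubC; first by rewrite szF szs.
  apply/(all_nthP 0) => i; rewrite szs => id; rewrite sE.
  by have /andP[] := fP' i id.
rewrite uniq_rootsE; apply: sorted_uniq srt.
  by move=> x y z xy yz; apply: lt_trans yz xy.
exact: ltxx.
Qed.

(** Reflecting x to -x reduces this to the behaviour at plus infinity. *)
Lemma poly_sign_ninfty (R : realType) (F : {poly R}) x :
  0 < lead_coef F ->
  exists2 y : R, y < x & 0 < (-1) ^+ (size F).-1 * F.[y].
Proof.
move=> lF; pose H := (-1) ^+ (size F).-1 *: (F \Po (- 'X)).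
have lH : lead_coef H = lead_coef F.
  rewrite lead_coefZ lead_coef_comp ?size_polyN ?size_polyX //.
  by rewrite lead_coefN lead_coefX mulrCA -exprMn mulrNN mulr1 expr1n mulr1.
have [|N HN] := @polyrcf.poly_pinfty_gt_lc R H; first by rewrite lH.
exists (- (Num.max N (- x) + 1)).
  have : - x <= Num.max N (- x) by rewrite le_max lexx orbT.
  by lra.
have : N <= Num.max N (- x) + 1.
  have : N <= Num.max N (- x) by rewrite le_max lexx.
  by lra.
move=> /HN; rewrite lH hornerZ horner_comp hornerN hornerX.
exact: lt_le_trans.
Qed.

Section Hypgeo.
Variable R : realType.

Lemma size_hypgeo p q : (p <= q)%N -> size (hypgeo R p q) = p.+1.
Proof.
move=> pq; apply: size_poly_eq; rewrite mulf_neq0 ?invr_eq0 ?pnatr_eq0 //.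
by rewrite -lt0n muln_gt0 !bin_gt0 leqnn pq.
Qed.

Lemma lead_coef_hypgeo_gt0 p q : (p <= q)%N -> 0 < lead_coef (hypgeo R p q).
Proof.
move=> pq; rewrite lead_coefE size_hypgeo // coef_hypgeo.
by rewrite divr_gt0 ?ltr0n // muln_gt0 !bin_gt0 leqnn pq.
Qed.

Lemma hypgeo_nonneg p q : nonneg_coefs (hypgeo R p q).
Proof. by move=> i; rewrite coef_hypgeo divr_ge0 ?ler0n. Qed.

Definition negative_zeros (F : {poly R}) (s : seq R) : Prop :=
  [/\ sorted >%R s, all (< 0) s & F = lead_coef F *: \prod_(a <- s) ('X - a%:P)].

Lemma hypgeo_interlace p q beta : (p < q)%N -> size beta = p ->
  negative_zeros (hypgeo R p q.+1) beta ->
  exists alpha : seq R,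
    [/\ negative_zeros (hypgeo R p.+1 q) alpha, size alpha = p.+1
      & forall i, (i < p)%N -> alpha`_i.+1 <= beta`_i <= alpha`_i].
Proof.
move=> pq szb [srt neg fact].
set G := hypgeo R p q.+1 in fact; set F := hypgeo R p.+1 q.
have lF : 0 < lead_coef F by apply: lead_coef_hypgeo_gt0.
have lG : 0 < lead_coef G by apply: lead_coef_hypgeo_gt0; lia.
have szF : size F = p.+2 by apply: size_hypgeo.
have [y yb ys] := poly_sign_ninfty (last 0 beta) lF.
rewrite szF /= in ys.
(* The test points are 0, the zeros [beta], then [y], which the default value of [nth] supplies at
   index [p.+1]. *)
pose b i := nth y (0 :: beta) i.
have bneg i : (i < p)%N -> beta`_i < 0.
  by move=> ip; apply: (allP neg); rewrite mem_nth ?szb.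
have bE i : (i < p)%N -> b i.+1 = beta`_i.
  by move=> ip; rewrite /b /= (set_nth_default 0) ?szb.
have by_ : b p.+1 = y by rewrite /b nth_default //= szb.
have bdec i : (i < p.+1)%N -> b i.+1 < b i.
  rewrite ltnS leq_eqVlt => /orP[/eqP -> | ip].
    by rewrite by_ /b -szb nth_last.
  have : sorted >%R (0 :: beta).
    rewrite /=; by case: (beta) neg srt => //= x t /andP[-> _] ->.
  by move=> /(sortedP y) /(_ i); apply; rewrite /= ltnS szb.
have bsgn i : (i <= p.+1)%N -> 0 < (-1) ^+ i * F.[b i].
  case: i => [_|i].
    by rewrite expr0 mul1r /b /= horner_coef0 coef_hypgeo !bin0 divr1 ltr01.
  rewrite ltnS leq_eqVlt => /orP[/eqP -> | ip]; first by rewrite by_.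
  rewrite bE //.
  (* At a zero of [G] only the derivative term survives; its factor x < 0 turns the sign (-1)^i into
     (-1)^(i+1). *)
  have := congr1 (fun P => P.[beta`_i]) (hypgeo_contiguous R (ltnW pq)).
  rewrite -/G -/F !(hornerZ, hornerD, hornerM, hornerN, hornerX, hornerC).
  have -> : G.[beta`_i] = 0.
    rewrite fact hornerZ (_ : (\prod_(_ <- _) _).[_] = 0) ?mulr0 //.
    by apply/rootP; rewrite root_prod_XsubC mem_nth ?szb.
  have G'sgn : 0 < (-1) ^+ i * (G^`()).[beta`_i].
    rewrite fact derivZ hornerZ mulrCA mulr_gt0 // deriv_prod_XsubC_sign ?szb //.
  have x0 := bneg i ip.
  have d0 : 0 < (q - p)%:R :> R by rewrite ltr0n subn_gt0.
  have c0 : 0 < q.+1%:R * p.+2%:R :> R by rewrite mulr_gt0 ?ltr0n.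
  rewrite mul0r mulr0 add0r => E.
  rewrite -(pmulr_rgt0 _ c0) exprS mulrCA E.
  have -> : -1 * (-1) ^+ i *
      ((q - p)%:R * ((1 - beta`_i) * (beta`_i * (G^`()).[beta`_i])))
     = (q - p)%:R * ((1 - beta`_i) * (- beta`_i))
       * ((-1) ^+ i * (G^`()).[beta`_i]) by ring.
  apply: mulr_gt0 => //; apply: mulr_gt0 => //;
  apply: mulr_gt0; last by rewrite oppr_gt0.
  by rewrite subr_gt0; apply: lt_trans x0 ltr01.
have [alpha [sza sa facta ab]] := zeros_of_sign_alternation szF bdec bsgn.
exists alpha; split=> //.
  split=> //; apply/(all_nthP 0) => i; rewrite sza => ip.
  have /andP[_ h] := ab i ip; apply: (lt_le_trans h).
  case: i ip {h} => [_|i ip]; first by rewrite /b.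
  by rewrite bE ?ltW ?bneg.
move=> i ip; have /andP[_ h1] := ab i.+1 ip; have /andP[h2 _] := ab i (ltnW ip).
by rewrite bE // in h1 h2; rewrite !ltW.
Qed.

(** Induction with p + q fixed: the sign argument yields the zeros of the next polynomial together
    with the interlacing. *)
Lemma hypgeo_negative_zeros p q : (p <= q)%N ->
  exists2 s : seq R, size s = p & negative_zeros (hypgeo R p q) s.
Proof.
elim: p q => [|p IH] q pq.
  exists [::] => //; split=> //; rewrite big_nil; set G := hypgeo R 0 q.
  have /size1_polyC E : (size G <= 1)%N by rewrite size_hypgeo.
  by rewrite [in LHS]E alg_polyC [in RHS]E lead_coefC.
have [|s szs ns] := IH q.+1; first by lia.
by have [t [nt szt _]] := hypgeo_interlace pq szs ns; exists t.
Qed.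

Lemma zeros_ofZX (c : R) F s : 0 < c -> negative_zeros F s -> F != 0 ->
  zeros_of (c *: ('X * F)) (0 :: s).
Proof.
move=> c0 [srt neg fact] F0; split.
- by rewrite scaler_eq0 mulf_eq0 polyX_eq0 !negb_or F0 gt_eqF.
- rewrite /=; case: s srt neg {fact} => //= x t xt /andP[x0 _].
  rewrite ltW //=; apply: sub_path xt => a b; exact: ltW.
- rewrite big_cons subr0 lead_coefZ lead_coefM lead_coefX mul1r -scalerA.
  by congr (_ *: _); rewrite {1}fact -scalerAr.
Qed.

Lemma interlacesZX_hypgeo (c d : R) p q : 0 < c -> 0 < d -> (p <= q)%N ->
  interlaces (c *: ('X * hypgeo R p q.+1)) (d *: ('X * hypgeo R p.+1 q)).
Proof.
move=> c0 d0 pq; left.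
have nnX (e : R) (F : {poly R}) : 0 < e ->
    nonneg_coefs F -> nonneg_coefs (e *: ('X * F)).
  move=> e0 nF i; rewrite coefZ coefXM mulr_ge0 ?(ltW e0) //.
  by case: i => //= i; apply: nF.
split; first by apply: nnX => //; apply: hypgeo_nonneg.
split; first by apply: nnX => //; apply: hypgeo_nonneg.
have nz p' q' : (p' <= q')%N -> hypgeo R p' q' != 0.
  by move=> h; rewrite -size_poly_gt0 size_hypgeo.
have [|s szs ns] := @hypgeo_negative_zeros p q.+1; first by lia.
(* For [p = q] the two polynomials [hypgeo] coincide by symmetry; otherwise the degrees differ by
   one. *)
move: pq; rewrite leq_eqVlt => /orP[/eqP Epq | pq].
  exists (0 :: s), (0 :: s); split.
  - by apply: zeros_ofZX => //; apply: nz; lia.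
  - have -> : hypgeo R p.+1 q = hypgeo R p q.+1 by rewrite hypgeoC Epq.
    by apply: zeros_ofZX => //; apply: nz; lia.
  left; split=> //; split=> // i; rewrite ltnS => ip.
  have [srt neg _] := ns.
  rewrite /=; case: i ip => [|i] ip.
    by rewrite ltW //; apply: (allP neg); rewrite mem_nth.
  by rewrite ltW //; apply: (sortedP 0 srt).
have [t [nt szt ts]] := hypgeo_interlace pq szs ns.
exists (0 :: s), (0 :: t); split.
- by apply: zeros_ofZX => //; apply: nz; lia.
- by apply: zeros_ofZX => //; apply: nz; lia.
right; split; first by rewrite /= szs szt.
case=> [_|i]; last by rewrite /= ltnS szs; apply: ts.
have [_ neg _] := nt; rewrite /= lexx andbT ltW //.
by apply: (allP neg); rewrite mem_nth ?szt.
Qed.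

End Hypgeo.

Theorem theorem2p7 (R : realType) (n : nat) (hn : (1 <= n)%N) :
  sturm_unimodal n (fun k : nat => W R n k).
Proof.
have c0 k : (0 < k < n)%N -> 0 < 'C(n.+1, k)%:R * k%:R / n.+1%:R :> R.
  by move=> kn; rewrite divr_gt0 ?mulr_gt0 ?ltr0n ?bin_gt0 //; lia.
(* With p = k-1 and q = n-k-2, the step from k to k+1 rises when p <= q, that is, when 2k <= n-1. *)
exists (n.-1./2).+1; split; first by lia.
  case=> [|k] kj; first by lia.
  rewrite !W_hypgeo; try lia.
  have -> : (n - k.+1).-1 = (n - k.+2).-1.+1 by lia.
  by apply: interlacesZX_hypgeo; [apply: c0; lia|apply: c0; lia|lia].
case=> [|k] kj; first by lia.
(* The last pair compares 1 with a multiple of x, which the convention on a ≼ bx + c settles. *)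
have [kn|nk] := ltnP k.+2 n; last first.
  have -> : n = k.+2 by lia.
  rewrite W_diag //; right; left.
  exists 1, ('C(k.+3, k.+1)%:R * k.+1%:R / k.+3%:R), 0; split=> //.
  rewrite W_hypgeo ?ltnSn // subSnn /= hypgeoC.
  have -> : hypgeo R 0 k = 1.
    apply/polyP => -[|j]; rewrite coef_hypgeo coef1 ?bin0 ?divr1 //.
    by rewrite mul0n mul0r.
  by rewrite mulr1 addr0.
rewrite !W_hypgeo; try lia.
(* Swapping the parameters reduces the falling half to the rising one. *)
rewrite (hypgeoC _ k.+2.-1) (hypgeoC _ k.+1.-1) /=.
have -> : (n - k.+1).-1 = (n - k.+2).-1.+1 by lia.
by apply: interlacesZX_hypgeo; [apply: c0; lia|apply: c0; lia|lia].
Qed.
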